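(* Let $p\ge 1$ be an integer and let $t\in[-1,1]$. Then $$\int_0^1\left\{t-\frac{Li_p[(1-y)t]}{1-y}\right\}\frac{dy}{\log y}=\sum_{n=1}^{\infty}\frac{t^{n+1}}{(n+1)^p}\sum_{k=0}^{n}\binom{n}{k}(-1)^{k+1}\log(1+k).$$
   Context: $Li_p(z)=\sum_{n=1}^{\infty}\frac{z^n}{n^p}$ is the polylogarithm. *)

(* Defs.v *)
From HB Require Import structures.
From mathcomp Require Import all_boot all_order all_algebra.
From mathcomp Require Import all_classical all_reals all_analysis.
Import Order.TTheory GRing.Theory Num.Theory.
Import numFieldNormedType.Exports.

Set Implicit Arguments.
Unset Strict Implicit.
Unset Printing Implicit Defensive.

Local Open Scope classical_set_scope.
Local Open Scope ring_scope.

(* Li_p(z) for real z; only meaningful where the series converges, in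
   particular for |z| < 1. *)
Definition polylog (R : realType) (p : nat) (z : R) : R :=
  \big[+%R/0]_(1 <= n <oo) (z ^+ n / n%:R ^+ p).

(* Main.v *)
Require Import Defs.
From HB Require Import structures.
From mathcomp Require Import all_boot all_order all_algebra.
From mathcomp Require Import all_classical all_reals all_analysis.
From mathcomp Require Import measurable_realfun ring lra.
Import Order.TTheory GRing.Theory Num.Theory.
Import numFieldNormedType.Exports.

Local Open Scope classical_set_scope.
Local Open Scope ring_scope.

(** Put x = 1 - y.  The first term of Li_p(x t) / x is t, so the integrand is
    the power series
      sum_(n >= 1) t^(n+1) / (n+1)^p * (x^n / (- ln y))   for 0 < y < 1
    ([cvg_series_kern]), and the theorem is the claim that it may be
    integrated term by term.

    Each term has an explicit integral.  Since n >= 1, the alternating sum of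
    the binomial coefficients vanishes, and the binomial theorem writes
    x^n / (- ln y) as a combination of the functions (y^k - 1) / ln y
    ([kern_sum]).  These are Frullani integrands: (y^k - 1) / ln y is the
    integral of y^s for s in [0, k], and exchanging the two integrations gives
    the integral of 1 / (1 + s), that is ln (1 + k) ([frullani]).

    The exchange of sum and integral is absolute for every t in [-1, 1].  From
    - ln y >= 1 - y one gets x^n / (- ln y) <= x^(n-1), whose integral is 1/n
    ([integral_kern_le]); since p >= 1, the n-th term has L^1 norm at most
    1 / (n (n+1)), a telescoping series, and dominated convergence applies
    ([termwise_integration]).  This also shows that the integrand is
    integrable and that the series on the right converges.

    Below, the term written x^n / (- ln y) here is [kern] at index n - 1. *)

(** * Term-by-term integration *)

(** Dominated convergence for the partial sums: the sum of the |u n| dominates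
    them all, and by monotone convergence its integral is the sum of the L^1
    norms. *)
Lemma termwise_integration (d : measure_display) (T : measurableType d)
    (R : realType) (mu : {measure set T -> \bar R}) (D : set T)
    (u : nat -> T -> R) (f : T -> R) :
  measurable D ->
  (forall n, mu.-integrable D (EFin \o u n)) ->
  (\sum_(n <oo) \int[mu]_(x in D) `|(u n x)%:E| < +oo)%E ->
  (forall x, D x -> series (u ^~ x) @ \oo --> f x) ->
  mu.-integrable D (EFin \o f) /\
  series (fun n => \int[mu]_(x in D) u n x) @ \oo --> \int[mu]_(x in D) f x.
Proof.
move=> mD iu su uf.
have mu_ n : measurable_fun D (u n).
  by apply/measurable_EFinP; case/integrableP: (iu n).
have mS N : measurable_fun D (fun x => series (u ^~ x) N).
  by rewrite /series/=; apply: measurable_sum.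
have mf : measurable_fun D f by exact: (measurable_fun_cvg mS).
pose g x := (\sum_(n <oo) `|(u n x)%:E|)%E.
have mau n : measurable_fun D (fun x => `|(u n x)%:E|%E).
  by apply/measurableT_comp => //; apply/measurable_EFinP.
have ig : mu.-integrable D g.
  apply/integrableP; split.
    exact: (@ge0_emeasurable_sum _ _ _ D (fun n x => `|(u n x)%:E|%E) xpredT).
  rewrite (@eq_integral _ _ _ mu D g) => [|x _]; last first.
    by rewrite gee0_abs//; apply: nneseries_ge0 => n _ _; exact: abse_ge0.
  by rewrite integral_nneseries.
have [||||| If _ cS] := @dominated_convergence _ _ _ mu D mD
    (fun N x => (series (u ^~ x) N)%:E) (EFin \o f) g.
- by move=> N; apply/measurable_EFinP.
- exact/measurable_EFinP.
- by apply: aeW => x Dx; apply: cvg_EFin; [exact: nearW|exact: uf].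
- exact: ig.
- apply: aeW => x N Dx; rewrite /series -sumEFin.
  apply: le_trans (lee_abs_sum _ _ _) _.
  by apply: nneseries_lim_ge => n _ _; exact: abse_ge0.
split => //.
have SE N : (\int[mu]_(x in D) (series (u ^~ x) N)%:E)%E =
            (series (fun n => \int[mu]_(x in D) u n x) N)%:E.
  rewrite /series -sumEFin; under eq_integral do rewrite -sumEFin.
  rewrite (integral_sum mD iu); apply: eq_bigr => n _.
  by rewrite /Rintegral fineK//; exact: (integrable_fin_num mD (iu n)).
move: cS; rewrite (_ : [sequence _]_n = (fun N =>
   (series (fun n => \int[mu]_(x in D) u n x) N)%:E)); last exact/funext.
rewrite -(fineK (integrable_fin_num mD If)).
by move/fine_cvgP => [].
Qed.

(** * The integral of (y^b - 1) / ln y *)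

Lemma FTC2_is_derive (R : realType) (f F : R -> R) (a b : R) :
  a < b -> {within `[a, b], continuous f} ->
  (forall x, a <= x <= b -> is_derive x 1 F (f x)) ->
  (\int[@lebesgue_measure R]_(x in `[a, b]) (f x)%:E = (F b)%:E - (F a)%:E)%E.
Proof.
move=> ab cf dF.
have cF x : a <= x <= b -> {for x, continuous F}.
  move=> xab; apply/differentiable_continuous/derivable1_diffP.
  by have [] := dF _ xab.
apply: continuous_FTC2 => //.
- split.
  + move=> x; rewrite in_itv/= => /andP[ax xb].
    by have [] := dF x; rewrite ?(ltW ax) ?(ltW xb).
  + by apply: cvg_at_right_filter; apply: cF; rewrite lexx ltW.
  + by apply: cvg_at_left_filter; apply: cF; rewrite lexx ltW.
- move=> x; rewrite in_itv/= => /andP[ax xb]; rewrite derive1E.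
  by have [] := dF x; rewrite ?(ltW ax) ?(ltW xb).
Qed.

Lemma continuous_powRr (R : realType) (y : R) : 0 < y ->
  continuous (fun s => y `^ s).
Proof.
move=> y0 s; rewrite (_ : (fun s => _) = (fun s => expR (s * ln y))).
  by apply: continuous_comp; [exact: mulrr_continuous|exact: continuous_expR].
by apply/funext => u; rewrite /powR gt_eqF.
Qed.

Lemma integral_powRr (R : realType) (y b : R) : 0 < y < 1 -> 0 < b ->
  (\int[@lebesgue_measure R]_(s in `[0%R, b]) (y `^ s)%:E =
   ((y `^ b - 1) / ln y)%:E)%E.
Proof.
move=> /andP[y0 y1] b0; have lny : ln y != 0 by rewrite lt_eqF// ln_lt0 ?y0.
rewrite [LHS](_ : _ = (y `^ b / ln y)%:E - (y `^ 0 / ln y)%:E)%E.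
  by rewrite powRr0 -EFinB -mulrBl.
apply: (@FTC2_is_derive _ (fun s => y `^ s) (fun s => y `^ s / ln y)) => //.
- exact/continuous_subspaceT/continuous_powRr.
- move=> s _; rewrite (_ : (fun s => _) = (fun s => (ln y)^-1 * expR (s * ln y))).
    apply: is_derive_eq.
    rewrite /powR gt_eqF// scaler0 add0r {1}/GRing.scale /=.
    by rewrite {1}/GRing.scale /= mulr1 mulrCA mulVf// mulr1.
  by apply/funext => u; rewrite /powR gt_eqF// mulrC.
Qed.

Lemma integral_inv1D (R : realType) (b : R) : 0 < b ->
  (\int[@lebesgue_measure R]_(s in `[0%R, b]) ((1 + s)^-1)%:E =
   (ln (1 + b))%:E)%E.
Proof.
move=> b0; rewrite [LHS](_ : _ = (ln (1 + b))%:E - (ln (1 + 0))%:E)%E.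
  by rewrite addr0 ln1 sube0.
apply: (@FTC2_is_derive _ (fun s => (1 + s)^-1) (fun s => ln (1 + s))) => //.
- apply: continuous_in_subspaceT => s; rewrite inE/= in_itv/= => /andP[s0 _].
  apply: cvgV; first by rewrite gt_eqF// ltr_pwDl.
  by apply: cvgD; [exact: cvg_cst|exact: cvg_id].
- move=> s /andP[s0 _]; have s1 : 0 < 1 + s by rewrite ltr_pwDl.
  have dl : is_derive (1 + s) 1 (@ln R) (1 + s)^-1 by exact: is_derive1_ln.
  have d1 : is_derive s 1 (fun s : R => 1 + s) 1.
    by rewrite -[X in is_derive _ _ _ X]add0r; exact: is_deriveD.
  by apply: (is_derive_eq (is_derive1_comp dl d1)); rewrite mulr1.
Qed.

(** Continuity at 0 is one-sided only: [powR] extends to negative bases by the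
    value 1, since [ln] vanishes there. *)
Lemma powR_within_continuous (R : realType) (s : R) : 0 < s ->
  {within `[0, 1], continuous (fun y : R => y `^ s)}.
Proof.
move=> s0.
have cp (x : R) : 0 < x -> {for x, continuous (fun y : R => y `^ s)}.
  move=> x0; apply/differentiable_continuous/derivable1_diffP.
  by apply: derivable_powR; rewrite in_itv/= x0.
apply/continuous_within_itvP => //; split.
- by move=> x; rewrite in_itv/= => /andP[x0 _]; exact: cp.
- by rewrite powR0 ?gt_eqF//; exact: powR_cvg0.
- by apply: cvg_at_left_filter; exact: cp.
Qed.

Lemma integral_powR (R : realType) (s : R) : 0 < s ->
  (\int[@lebesgue_measure R]_(y in `]0%R, 1%R[) (y `^ s)%:E =
   ((1 + s)^-1)%:E)%E.
Proof.
move=> s0; have s1 : 0 < 1 + s by rewrite addr_gt0.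
rewrite -(@integral_itv_bndoo _ _ _ _ true false); last first.
  by apply/measurable_EFinP/measurable_funTS; exact: measurable_powR.
rewrite (@continuous_FTC2 _ _ (fun y => (1 + s)^-1 * y `^ (1 + s)))//.
- by rewrite powR1 powR0 ?gt_eqF// mulr0 mulr1 sube0.
- exact: powR_within_continuous.
- have [_ c0 c1] := (continuous_within_itvP _ (@ltr01 R)).1
    (@powR_within_continuous _ _ s1).
  split.
  + move=> x; rewrite in_itv/= => /andP[x0 _]; apply: derivableM => //.
    by apply: derivable_powR; rewrite in_itv/= x0.
  + by apply: cvgM => //; exact: cvg_cst.
  + by apply: cvgM => //; exact: cvg_cst.
- move=> x; rewrite in_itv/= => /andP[x0 _].
  have x0' : x \in `]0, +oo[ by rewrite in_itv/= x0.
  rewrite derive1Ml ?powR_derive1//; last exact: derivable_powR.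
  by rewrite mulrA mulVf ?gt_eqF// mul1r addrAC subrr add0r.
Qed.

(** Tonelli's theorem over the rectangle A x B, obtained from the one on the
    whole plane by multiplying the integrand by the two indicators. *)
Lemma tonelli_in (R : realType) (A B : set R) (f : R -> R -> R) :
  measurable A -> measurable B ->
  measurable_fun [set: R * R] (fun z => f z.1 z.2) ->
  (forall s y, 0 <= f s y) ->
  (\int[@lebesgue_measure R]_(s in A) \int[@lebesgue_measure R]_(y in B)
     (f s y)%:E =
   \int[@lebesgue_measure R]_(y in B) \int[@lebesgue_measure R]_(s in A)
     (f s y)%:E)%E.
Proof.
move=> mA mB mf f0.
pose h (z : R * R) : \bar R := (\1_A z.1 * (\1_B z.2 * f z.1 z.2))%:E.
have mh : measurable_fun setT h.
  apply/measurable_EFinP/measurable_funM.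
    by apply: measurableT_comp => //; exact: measurable_indic.
  apply: measurable_funM => //.
  by apply: measurableT_comp => //; exact: measurable_indic.
have h0 z : (0 <= h z)%E by rewrite lee_fin !mulr_ge0.
transitivity (\int[@lebesgue_measure R]_s \int[@lebesgue_measure R]_y h (s, y))%E.
  rewrite integral_mkcond; apply: eq_integral => s _; rewrite patchE /h/= indicE.
  case: ifPn => [sA|sA].
    rewrite integral_mkcond; apply: eq_integral => y _; rewrite patchE indicE.
    by case: ifPn; rewrite !mul1r// mul0r.
  by under eq_integral do rewrite mul0r; rewrite integral0.
rewrite fubini_tonelli//.
rewrite [RHS]integral_mkcond; apply: eq_integral => y _; rewrite patchE /h/= indicE.
case: ifPn => [yB|yB].
  rewrite [RHS]integral_mkcond; apply: eq_integral => s _; rewrite patchE indicE.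
  by case: ifPn; rewrite !mul1r// mul0r.
by under eq_integral do rewrite mul0r mulr0; rewrite integral0.
Qed.

(** Both sides are the integral of y^s over 0 < s < b, 0 < y < 1, computed in
    the two possible orders. *)
Lemma frullani (R : realType) (b : R) : 0 <= b ->
  (\int[@lebesgue_measure R]_(y in `]0%R, 1%R[) ((y `^ b - 1) / ln y)%:E =
   (ln (1 + b))%:E)%E.
Proof.
rewrite le_eqVlt => /predU1P[<-|b0].
  under eq_integral do rewrite powRr0 subrr mul0r.
  by rewrite integral0 addr0 ln1.
(* exp (s ln y) agrees with y^s for y > 0 and is jointly measurable on the
   whole plane; s avoids 0 because [integral_powR] is about s > 0. *)
transitivity (\int[@lebesgue_measure R]_(y in `]0%R, 1%R[)
    \int[@lebesgue_measure R]_(s in `]0%R, b[) (expR (s * ln y))%:E)%E.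
  apply: eq_integral => y; rewrite inE/= in_itv/= => y01.
  have y0 : 0 < y by case/andP: y01.
  rewrite -integral_powRr//.
  rewrite (@integral_itv_bndoo _ _ _ _ true false); last first.
    by apply/measurable_EFinP/measurable_funTS; exact: measurable_powRr.
  by apply: eq_integral => s _; rewrite /powR gt_eqF.
rewrite -tonelli_in//; last first.
  apply: (measurableT_comp (@measurable_expR R)); apply: measurable_funM => //.
  exact: (measurableT_comp (@measurable_ln R)).
transitivity (\int[@lebesgue_measure R]_(s in `]0%R, b[) ((1 + s)^-1)%:E)%E.
  apply: eq_integral => s; rewrite inE/= in_itv/= => /andP[s0 _].
  rewrite -integral_powR//; apply: eq_integral => y.
  by rewrite inE/= in_itv/= => /andP[y0 _]; rewrite /powR gt_eqF.
rewrite -integral_inv1D// (@integral_itv_bndoo _ _ _ _ true false)//.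
apply/measurable_EFinP; apply: open_continuous_measurable_fun => // s.
rewrite inE/= in_itv/= => /andP[s0 _].
apply: cvgV; first by rewrite gt_eqF// addr_gt0.
by apply: cvgD; [exact: cvg_cst|exact: cvg_id].
Qed.

(** * The kernels (1 - y)^(n+1) / (- ln y) *)

Lemma measurable_inv_ln (R : realType) :
  measurable_fun (`]0, 1[ : set R) (fun y : R => (ln y)^-1).
Proof.
apply: open_continuous_measurable_fun => // y.
rewrite inE/= in_itv/= => y01; have y0 : 0 < y by case/andP: y01.
by apply: cvgV; [rewrite lt_eqF// ln_lt0|exact: continuous_ln].
Qed.

(** The function is nonnegative and its integral is finite by [frullani]. *)
Lemma integrable_frullani (R : realType) (k : nat) :
  (@lebesgue_measure R).-integrable `]0%R, 1%R[
    (fun y => ((y ^+ k - 1) / ln y)%:E).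
Proof.
apply/integrableP; split.
  apply/measurable_EFinP; apply: measurable_funM; last exact: measurable_inv_ln.
  by apply: measurable_funTS; apply: measurable_funB => //; exact: exprn_measurable.
rewrite (@eq_integral _ _ _ (@lebesgue_measure R) _
    (fun y : R => ((y `^ k%:R - 1) / ln y)%:E)).
  by rewrite frullani// ltry.
move=> y; rewrite inE/= in_itv/= => /andP[y0 y1].
rewrite ger0_norm ?powR_mulrn// ?(ltW y0)//.
rewrite mulr_le0// ?invr_le0 ?ln_le0 ?(ltW y1)// subr_le0.
by rewrite exprn_ile1 ?(ltW y0) ?(ltW y1).
Qed.

(** The exponent is n + 1, and not n, because 1 / (- ln y) itself is not
    integrable near y = 1. *)
Definition kern (R : realType) (n : nat) (y : R) : R :=
  (1 - y) ^+ n.+1 / - ln y.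

(** The binomial theorem, after subtracting its instance at y = 1, which is 0
    because the exponent is positive.  The subtraction makes every summand
    integrable separately. *)
Lemma kern_sum (R : realType) (n : nat) (y : R) :
  kern R n y = \sum_(0 <= k < n.+2)
    'C(n.+1, k)%:R * (-1) ^+ k.+1 * ((y ^+ k - 1) / ln y).
Proof.
have E (x : R) : \sum_(0 <= k < n.+2) 'C(n.+1, k)%:R * (-1) ^+ k * x ^+ k =
    (1 - x) ^+ n.+1.
  rewrite big_mkord exprBn; apply: eq_bigr => k _.
  by rewrite expr1n mulr1 -[RHS]mulr_natl mulrA.
have := E 1; rewrite subrr expr0n/= => E1.
transitivity (- (\sum_(0 <= k < n.+2) 'C(n.+1, k)%:R * (-1) ^+ k * y ^+ k -
    \sum_(0 <= k < n.+2) 'C(n.+1, k)%:R * (-1) ^+ k * 1 ^+ k) / ln y).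
  by rewrite E E1 subr0 /kern invrN mulrN mulNr.
rewrite -sumrB -sumrN mulr_suml.
by apply: eq_bigr => k _; rewrite expr1n exprS; ring.
Qed.

Lemma kern_ge0 (R : realType) (n : nat) (y : R) : 0 < y < 1 -> 0 <= kern R n y.
Proof.
move=> /andP[y0 y1]; rewrite mulr_ge0 ?exprn_ge0 ?subr_ge0 ?(ltW y1)//.
by rewrite invr_ge0 oppr_ge0 ln_le0// ltW.
Qed.

(** From ln y <= y - 1: dividing by - ln y costs at most one factor 1 - y. *)
Lemma kern_le (R : realType) (n : nat) (y : R) :
  0 < y < 1 -> kern R n y <= (1 - y) ^+ n.
Proof.
move=> y01; have /andP[y0 y1] := y01.
rewrite /kern ler_pdivrMr ?oppr_gt0 ?ln_lt0// exprSr ler_wpM2l//.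
  by rewrite exprn_ge0// subr_ge0 ltW.
have := @le_ln1Dx R (y - 1); rewrite (addrC 1) subrK => ly.
suff : ln y <= y - 1 by lra.
by apply: ly; lra.
Qed.

Lemma integrable_kern (R : realType) (n : nat) :
  (@lebesgue_measure R).-integrable `]0%R, 1%R[ (EFin \o kern R n).
Proof.
rewrite (_ : EFin \o _ = fun y => (\sum_(0 <= k < n.+2)
    ('C(n.+1, k)%:R * (-1) ^+ k.+1)%:E * ((y ^+ k - 1) / ln y)%:E)%E).
  apply: integrable_sum => // k _; apply: integrableZl => //.
  exact: integrable_frullani.
by apply/funext => y; rewrite /= kern_sum -sumEFin.
Qed.

Lemma Rintegral_kern (R : realType) (n : nat) :
  \int[@lebesgue_measure R]_(y in `]0, 1[) kern R n y =
  \sum_(0 <= k < n.+2) 'C(n.+1, k)%:R * (-1) ^+ k.+1 * ln (1 + k%:R).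
Proof.
rewrite /Rintegral.
under eq_integral do rewrite kern_sum -sumEFin.
rewrite integral_sum//; last first.
  by move=> k; apply: (integrableZl _ _ (integrable_frullani R k)).
rewrite (eq_bigr (fun k : nat =>
  ('C(n.+1, k)%:R * (-1) ^+ k.+1 * ln (1 + k%:R))%:E)) ?sumEFin// => k _.
under eq_integral do rewrite EFinM.
rewrite integralZl//; last exact: integrable_frullani.
rewrite [RHS]EFinM -frullani//; congr (_ * _)%E; apply: eq_integral => y.
by rewrite inE/= in_itv/= => /andP[y0 _]; rewrite powR_mulrn// ltW.
Qed.

Lemma integral_kern_le (R : realType) (n : nat) :
  (\int[@lebesgue_measure R]_(y in `]0%R, 1%R[) (kern R n y)%:E <=
   (n.+1%:R^-1)%:E)%E.
Proof.
have mX : measurable_fun setT (fun y : R => (1 - y) ^+ n).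
  by apply: measurable_funX; exact: measurable_funB.
apply: (@le_trans _ _
    (\int[@lebesgue_measure R]_(y in `[0%R, 1%R]) ((1 - y) ^+ n)%:E)%E).
  rewrite (@integral_itv_bndoo _ _ _ _ true false); last first.
    exact/measurable_EFinP/measurable_funTS.
  apply: ge0_le_integral => //.
  - by move=> y /= y01; rewrite lee_fin kern_ge0.
  - by case/integrableP: (integrable_kern R n).
  - exact/measurable_EFinP/measurable_funTS.
  - by move=> y /= y01; rewrite lee_fin kern_le.
rewrite -Rintegral_onemXn /Rintegral fineK//.
apply: integrable_fin_num => //; apply: continuous_compact_integrable.
  exact: segment_compact.
by apply: continuous_subspaceT => y; exact: continuous_onemXn.
Qed.

(** Comparison with the geometric series in |z|.  The limit is [polylog] by its
    definition once it is known to exist. *)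
Lemma cvg_polylog (R : realType) (p : nat) (z : R) : `|z| < 1 ->
  (fun N : nat => \sum_(1 <= n < N) z ^+ n / n%:R ^+ p) @ \oo --> polylog p z.
Proof.
move=> z1; suff: cvgn (fun N : nat => \sum_(1 <= n < N) z ^+ n / n%:R ^+ p) by [].
apply/cvg_ex.
have /cvg_ex[l sl] : cvgn (series (fun n => z ^+ n.+1 / n.+1%:R ^+ p)).
  apply: normed_cvg; apply: (@series_le_cvg _ _ (geometric 1 `|z|)) => [n|n|n|].
  - exact: normr_ge0.
  - by rewrite /= mul1r exprn_ge0.
  - rewrite /= mul1r normrM normfV normrX -[leRHS]mulr1.
    rewrite ler_pM ?invr_ge0//.
      by rewrite exprS ler_piMl ?exprn_ge0// ltW.
    by rewrite invf_le1 ger0_norm ?exprn_ege1 ?exprn_gt0 ?ler1n.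
  - by apply: is_cvg_geometric_series; rewrite normr_id.
exists l; rewrite -cvg_shiftS.
by under eq_fun do rewrite big_add1.
Qed.

(** * Expansion and integration of the integrand *)

Lemma sum_inv_pronic (R : realType) (N : nat) :
  \sum_(0 <= n < N) (n.+1%:R * n.+2%:R)^-1 = 1 - N.+1%:R^-1 :> R.
Proof.
elim: N => [|N IH]; first by rewrite big_geq// invr1 subrr.
rewrite big_nat_recr//= IH.
have : N.+2%:R != 0 :> R by rewrite pnatr_eq0.
have : N.+1%:R != 0 :> R by rewrite pnatr_eq0.
rewrite -[N.+2%:R]natr1; move: (N.+1%:R : R) => x x0 x1.
by field; rewrite x0 x1.
Qed.

(** With x = 1 - y, the term of degree 1 of Li_p(x t), divided by x, cancels
    the isolated t of the limit. *)
Lemma cvg_series_kern (R : realType) (p : nat) (t y : R) :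
  `|t| <= 1 -> 0 < y < 1 ->
  series (fun n => t ^+ n.+2 / n.+2%:R ^+ p * kern R n y) @ \oo -->
  (t - polylog p ((1 - y) * t) / (1 - y)) / ln y.
Proof.
move=> t1 y01; have /andP[y0 y1] := y01.
have x0 : 1 - y != 0 by rewrite gt_eqF// subr_gt0.
have lny : ln y != 0 by rewrite lt_eqF// ln_lt0.
have z1 : `|(1 - y) * t| < 1.
  rewrite normrM ger0_norm ?subr_ge0 ?(ltW y1)//.
  apply: (@le_lt_trans _ _ (1 - y)); last by rewrite gtrBl.
  by rewrite ler_piMr// subr_ge0 ltW.
(* The sum up to N + 2 of the polylogarithm has the term z = (1 - y) t and N
   further ones, matched with the first N terms of the kernel series. *)
have := @cvg_polylog R p _ z1; rewrite -cvg_shiftS -cvg_shiftS => cL.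
rewrite (_ : series _ = (fun N => (t -
    (\sum_(1 <= n < N.+2) ((1 - y) * t) ^+ n / n%:R ^+ p) / (1 - y)) / ln y)).
  apply: cvgM; last exact: cvg_cst.
  apply: cvgB; first exact: cvg_cst.
  by apply: cvgM; [exact: cL|exact: cvg_cst].
apply/funext => N; rewrite /series/= big_nat_recl// big_add1/=.
rewrite expr1n divr1 expr1 [X in t - X]mulrDl [(1 - y) * t]mulrC mulfK//.
rewrite opprD addrA subrr sub0r mulr_suml -sumrN mulr_suml; apply: eq_bigr => n _.
rewrite /kern invrN exprMn [(1 - y) ^+ n.+2]exprSr.
set c := n.+2%:R ^+ p; set a := _ ^+ n.+1; set b := t ^+ _.
by field; rewrite lny x0 expf_neq0 ?pnatr_eq0.
Qed.

Theorem mainTheorem7 (R : realType) (p : nat) (t : R)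
    (hp : (1 <= p)%N) (ht : -1 <= t <= 1) :
  let mu := @lebesgue_measure R in
  let f := fun y : R => (t - polylog p ((1 - y) * t) / (1 - y)) / ln y in
  let a := fun n : nat =>
    t ^+ n.+1 / n.+1%:R ^+ p *
      \sum_(0 <= k < n.+1) 'C(n, k)%:R * (-1) ^+ k.+1 * ln (1 + k%:R) in
  [/\ mu.-integrable `]0, 1[ (EFin \o f),
      cvgn (fun N : nat => \sum_(1 <= n < N) a n) &
      \int[mu]_(y in `]0, 1[) f y = \big[+%R/0]_(1 <= n <oo) a n].
Proof.
move=> mu f a.
have t1 : `|t| <= 1 by rewrite ler_norml.
(* The index is shifted by one: u n is the term of index n + 1 of the series. *)
pose u n (y : R) := t ^+ n.+2 / n.+2%:R ^+ p * kern R n y.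
have iu n : mu.-integrable `]0, 1[ (EFin \o u n).
  rewrite (_ : EFin \o _ = fun y =>
      ((t ^+ n.+2 / n.+2%:R ^+ p)%:E * (kern R n y)%:E)%E).
    by apply: integrableZl => //; exact: integrable_kern.
  by apply/funext => y; rewrite /= EFinM.
have au n : a n.+1 = \int[mu]_(y in `]0, 1[) u n y.
  by rewrite RintegralZl//; [rewrite Rintegral_kern|exact: integrable_kern].
have bu n : (\int[mu]_(y in `]0%R, 1%R[) `|(u n y)%:E| <=
             ((n.+1%:R * n.+2%:R)^-1)%:E)%E.
  have cn : `|t ^+ n.+2 / n.+2%:R ^+ p| <= n.+2%:R^-1.
    rewrite normrM normrX normfV normrX normr_nat -[leRHS]mul1r.
    rewrite ler_pM ?exprn_ile1// lef_pV2 ?posrE ?exprn_gt0//.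
    by rewrite -[leLHS]expr1 ler_weXn2l// ler1n.
  apply: (@le_trans _ _ (\int[mu]_(y in `]0%R, 1%R[)
      ((n.+2%:R^-1)%:E * (kern R n y)%:E))%E).
    apply: ge0_le_integral => //.
    - apply/measurableT_comp => //.
      by case/integrableP: (iu n).
    - apply: emeasurable_funM => //.
      by case/integrableP: (integrable_kern R n).
    - move=> y /= y01; rewrite lee_fin normrM (ger0_norm (kern_ge0 R n y y01)).
      by rewrite ler_wpM2r ?kern_ge0.
  rewrite integralZl//; last exact: integrable_kern.
  rewrite mulrC invfM EFinM; apply: lee_wpmul2l => //; exact: integral_kern_le.
have [|||If Sf] := termwise_integration _ _ _ mu `]0, 1[ u f _ iu.
- by [].
- apply: (@le_lt_trans _ _ 1%E); last exact: ltry.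
  apply: lime_le.
    by apply: is_cvg_nneseries => n _ _; apply: integral_ge0.
  apply: nearW => N; apply: (@le_trans _ _ (1 - N.+1%:R^-1)%:E).
    rewrite -sum_inv_pronic -sumEFin; apply: lee_sum => n _; exact: bu.
  by rewrite lee_fin gerBl.
- by move=> y /=; rewrite in_itv/= => y01; exact: cvg_series_kern.
have Sa : (fun N : nat => \sum_(1 <= n < N) a n) @ \oo -->
          \int[mu]_(y in `]0, 1[) f y.
  rewrite -cvg_shiftS; apply: cvg_trans Sf.
  apply: near_eq_cvg; apply: nearW => N; rewrite /series/= big_add1/=.
  by apply: eq_bigr => n _; rewrite au.
split => //; first by apply/cvg_ex; exists (\int[mu]_(y in `]0, 1[) f y).
by apply/esym/cvg_lim.
Qed.
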